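(* Let $(\mathbb V,\mathbb E,\mathbf P,\mathcal W)$ be a weighted Markovian graph satisfying assumption (A) (see context). Then the matrix $\mathbf M$ of mean weighted first passage times satisfies $$[\mathbf M]_{\mathrm{dg}}=\big(\boldsymbol\pi(\mathbf P\circ\mathbf W)\mathbf 1\big)\,[\mathbf L]_{\mathrm{dg}}=\big(\boldsymbol\pi(\mathbf P\circ\mathbf W)\mathbf 1\big)\,\Xi^{-1}$$ and $$\mathbf M=\Big(\mathbf Z(\mathbf P\circ\mathbf W)\Pi-\mathbf 1\mathbf 1^\top[\mathbf Z(\mathbf P\circ\mathbf W)\Pi]_{\mathrm{dg}}+\big(\boldsymbol\pi(\mathbf P\circ\mathbf W)\mathbf 1\big)\big(\mathbf I-\mathbf Z+\mathbf 1\mathbf 1^\top[\mathbf Z]_{\mathrm{dg}}\big)\Big)\Xi^{-1}.$$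
   Context: Weighted Markovian graph $(\mathbb V,\mathbb E,\mathbf P,\mathcal W)$: $\mathbb V=\{1,\dots,n\}$; $\mathbb E\subseteq\mathbb V\times\mathbb V$; the graph is strongly connected; $\mathbf P$ is a row-stochastic $n\times n$ matrix with $\mathbf P(i,j)\ge 0$ for $(i,j)\in\mathbb E$ and $\mathbf P(i,j)=0$ otherwise, assumed irreducible and (unless otherwise stated) aperiodic. The weights $\mathcal W(i,j)$ (random, or deterministic as a special case) take values in $[\epsilon,\infty)$ for $(i,j)\in\mathbb E$, for some $\epsilon>0$, and are zero otherwise. Assumption (A): $\mathbf P$ has a unique stationary distribution $\boldsymbol\pi$ (a row vector), and $\mathbf W(i,j)=\mathbb E[\mathcal W(i,j)]<\infty$, $\mathbf W^{(2)}(i,j)=\mathbb E[\mathcal W(i,j)^2]<\infty$ for $(i,j)\in\mathbb E$. Let $(\hat X_k)_{k\ge0}$ be the Markov chain with transition matrix $\mathbf P$. For $\hat X_0=i$ let $\hat\tau(i,j)=\inf\{m\ge1:\hat X_m=j\}$ (first return time if $i=j$), and let $\tau(i,j)$ be the sum of the weights $\mathcal W(\hat X_{k-1},\hat X_k)$ over the transitions $k=1,\dots,\hat\tau(i,j)$; the weights are independent of the chain, so a traversal of edge $(a,b)$ has conditional mean weight $\mathbf W(a,b)$. Set $\mathbf M(i,j)=\mathbb E[\tau(i,j)]$ and $\mathbf L(i,j)=\mathbb E[\hat\tau(i,j)]$. Notation: $\circ$ is the entrywise product; $\mathbf 1$ is the all-ones column vector; $[\cdot]_{\mathrm{dg}}$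 sets all off-diagonal entries of a matrix to zero; $\Xi=\mathrm{diag}(\boldsymbol\pi(1),\dots,\boldsymbol\pi(n))$; $\Pi=\mathbf 1\boldsymbol\pi$; $\mathbf Z=(\mathbf I-\mathbf P+\Pi)^{-1}$. *)

(* Defs.v *)
From HB Require Import structures.
From mathcomp Require Export all_boot all_order all_algebra.
From mathcomp Require Export all_classical all_reals all_analysis.

Set Implicit Arguments.
Unset Strict Implicit.
Unset Printing Implicit Defensive.

Import Order.TTheory GRing.Theory Num.Theory.
Local Open Scope classical_set_scope.
Local Open Scope ring_scope.

Definition row_stochastic (R : realType) (n : nat) (P : 'M[R]_n) : Prop :=
  (forall i j, 0 <= P i j) /\ (forall i, \sum_j P i j = 1).

Definition irreducible_mx (R : realType) (n : nat) (P : 'M[R]_n) : Prop :=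
  forall i j, exists2 m : nat, (0 < m)%N & 0 < (P ^+ m) i j.

(* For every i, the gcd of { m >= 1 | P^m(i,i) > 0 } is 1. *)
Definition aperiodic_mx (R : realType) (n : nat) (P : 'M[R]_n) : Prop :=
  forall (i : 'I_n) (d : nat),
    (forall m : nat, (0 < m)%N -> 0 < (P ^+ m) i i -> (d %| m)%N) -> d = 1%N.

Definition stationary (R : realType) (n : nat) (P : 'M[R]_n) (pi : 'rV[R]_n) :
  Prop :=
  [/\ forall i, 0 <= pi 0 i, \sum_i pi 0 i = 1 & pi *m P = pi].

Definition weight_range (R : realType) (n : nat) (edge : rel 'I_n) (eps : R)
    (T : Type) (w : 'I_n -> 'I_n -> T -> R) : Prop :=
  forall i j t, (edge i j -> eps <= w i j t) /\ (~~ edge i j -> w i j t = 0).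

(* The random weights [W] are defined on a probability space of their own; no
   assumption is made on their joint law.  Deterministic weights are the case
   of constant functions. *)
Record weighted_markovian_graph (R : realType) (n : nat) (edge : rel 'I_n)
    (P : 'M[R]_n) (eps : R) (dT : measure_display) (T : measurableType dT)
    (W : 'I_n -> 'I_n -> {mfun T >-> R}) : Prop := {
  wmg_connected : forall i j, connect edge i j;
  wmg_support : forall i j, ~~ edge i j -> P i j = 0;
  wmg_stochastic : row_stochastic P;
  wmg_irreducible : irreducible_mx P;
  wmg_aperiodic : aperiodic_mx P;
  wmg_eps_gt0 : 0 < eps;
  wmg_weight_range : weight_range edge eps (fun i j => W i j : T -> R)
}.

Record assumptionA (R : realType) (n : nat) (edge : rel 'I_n)
    (P : 'M[R]_n) (pi : 'rV[R]_n) (dT : measure_display)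
    (T : measurableType dT) (Q : probability T R)
    (W : 'I_n -> 'I_n -> {mfun T >-> R}) : Prop := {
  asmA_stationary : unique (stationary P) pi;
  asmA_moment1 : forall i j, edge i j -> ('E_Q[W i j] < +oo)%E;
  asmA_moment2 : forall i j, edge i j ->
    ('E_Q[(fun t => (W i j t : R) ^+ 2)%R] < +oo)%E
}.

Definition mean_weight (R : realType) (n : nat) (dT : measure_display)
    (T : measurableType dT) (Q : probability T R)
    (W : 'I_n -> 'I_n -> {mfun T >-> R}) : 'M[R]_n :=
  \matrix_(i, j) fine ('E_Q[W i j])%E.

Section chain.
Variables (R : realType) (n : nat) (d : measure_display)
  (Omega : measurableType d).
Implicit Types (X : nat -> Omega -> 'I_n)
  (w : nat -> 'I_n -> 'I_n -> {mfun Omega >-> R}).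

(* [mc_step] is P(X_(k+1) = x_(k+1) | X_0 = x_0, ..., X_k = x_k)
   = P(x_k, x_(k+1)), multiplied out so that conditioning events of
   probability zero need no special treatment. *)
Record markov_chain (mu : probability Omega R) (P : 'M[R]_n) (i : 'I_n)
    (X : nat -> Omega -> 'I_n) : Prop := {
  mc_measurable : forall k a, measurable (X k @^-1` [set a]);
  mc_start : mu (X 0%N @^-1` [set i]) = 1%E;
  mc_step : forall (k : nat) (x : nat -> 'I_n),
    mu [set om | forall l, (l <= k.+1)%N -> X l om = x l] =
    (mu [set om | forall l, (l <= k)%N -> X l om = x l]
       * (P (x k) (x k.+1))%:E)%E
}.

Definition sigma_chain X : set (set Omega) :=
  <<s [set A | exists k a, A = X k @^-1` [set a]] >>.

Definition sigma_weights w : set (set Omega) :=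
  <<s [set B | exists k a b (C : set R),
         measurable C /\ B = w k a b @^-1` C] >>.

(* [w k a b] is the weight collected if the k-th transition traverses the edge
   (a, b).  It is a copy of [W a b]; copies attached to different transitions
   may be independent, all equal (weights drawn once and for all), or dependent
   in any other way.  Only independence of the whole family from the chain is
   required. *)
Record traversal_weights (mu : probability Omega R) (edge : rel 'I_n)
    (eps : R) (dT : measure_display) (T : measurableType dT)
    (Q : probability T R) (W : 'I_n -> 'I_n -> {mfun T >-> R})
    (X : nat -> Omega -> 'I_n)
    (w : nat -> 'I_n -> 'I_n -> {mfun Omega >-> R}) : Prop := {
  tw_range : forall k, weight_range edge eps (fun a b => w k a b : Omega -> R);
  tw_law : forall k a b (C : set R), measurable C ->
    distribution mu (w k a b) C = distribution Q (W a b) C;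
  tw_indep : forall A B, sigma_chain X A -> sigma_weights w B ->
    mu (A `&` B) = (mu A * mu B)%E
}.

(* inf { m >= 1 | X_m = j }, equal to +oo if j is never visited. *)
Definition hitting_time X (j : 'I_n) (om : Omega) : \bar R :=
  ereal_inf [set (m%:R : R)%:E | m in [set m : nat | (0 < m)%N /\ X m om = j]].

Definition weighted_hitting_time X w (j : 'I_n) (om : Omega) : \bar R :=
  (\sum_(1 <= k <oo | ((k%:R : R)%:E <= hitting_time X j om)%E)
     (w k (X k.-1 om) (X k om) om)%:E)%E.

(* [mu i] is the law under which the chain starts at i.  The entries are
   extended reals: that they are finite is not assumed. *)
Definition mfpt (mu : 'I_n -> probability Omega R) X : 'M[\bar R]_n :=
  \matrix_(i, j) (\int[mu i]_om hitting_time X j om)%E.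

Definition mwfpt (mu : 'I_n -> probability Omega R) X w : 'M[\bar R]_n :=
  \matrix_(i, j) (\int[mu i]_om weighted_hitting_time X w j om)%E.

End chain.

Definition dg (V : nmodType) (n : nat) (A : 'M[V]_n) : 'M[V]_n :=
  diag_mx (\row_i A i i).

Definition hadamard (R : realType) (n : nat) (A B : 'M[R]_n) : 'M[R]_n :=
  map2_mx *%R A B.

Definition ones (R : realType) (n : nat) : 'cV[R]_n := const_mx 1.

Definition Zmx (R : realType) (n : nat) (P : 'M[R]_n) (pi : 'rV[R]_n) :
  'M[R]_n := invmx (1%:M - P + ones R n *m pi).

(* Main.v *)
Require Import Defs.
From mathcomp Require Import measurable_realfun.
Import Order.TTheory GRing.Theory Num.Theory.
Local Open Scope classical_set_scope.
Local Open Scope ring_scope.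

(** Fix a target [j] and kill the chain on entering [j]. The weighted passage
    time to [j] is the sum over [k >= 0] of the weight of transition [k.+1] on
    the event that [j] was not entered at times 1, ..., [k]. This event and the
    endpoints of the transition concern the chain only, so by independence the
    [k]-th term has mean [(T ^+ k *m r) i 0], where [T] is the transition matrix
    of the killed chain ([taboo]) and [r] holds the mean weights of one
    transition from each state ([expected_weight], resting on
    [markov_property] and [integral_indep]). All terms are nonnegative, so the
    mean passage time is the series of these numbers, possibly infinite.

    It remains to sum the series. Irreducibility gives a minimum principle for
    the killed chain ([taboo_minimum]): a function that dominates its own killed
    average is nonnegative. Hence the first-step equation [x = r + T x] has at
    most one solution, every solution is nonnegative and bounds the partial sums
    of the series, and the series converges to the solution as soon as one
    exists ([taboo_series]). The closed form of the theorem is a solution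
    ([passage_mx_eq]): this is a computation with [(I - P) Z = I - 1 pi], where
    the invertibility behind [Z] and the positivity of [pi] follow again from
    irreducibility ([fundamental_unit], [stationary_gt0]).

    The diagonal of the closed form is read off directly ([passage_mx_diag]).
    The unweighted times [L] are the case of unit weights, in which the mean
    stationary weight of one transition is 1. *)

Set Implicit Arguments.
Unset Strict Implicit.
Unset Printing Implicit Defensive.

(** * The chain killed at a state *)

Section LinearAlgebra.
Variables (R : realType) (n : nat).
Implicit Types (P B : 'M[R]_n) (pi : 'rV[R]_n) (x r : 'cV[R]_n).

(** The sub-stochastic matrix of the chain killed on entering [j]: its [k]-th
    power gives the law of [X k] on the event that none of [X 1], ..., [X k]
    is [j]. *)
Definition taboo P (j : 'I_n) : 'M[R]_n := \matrix_(a, b) (P a b *+ (b != j)).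

Lemma taboo_ge0 P j : (forall a b, 0 <= P a b) ->
  forall a b, 0 <= taboo P j a b.
Proof. by move=> P0 a b; rewrite mxE mulrn_wge0. Qed.

(** A set of states that is closed under positive transitions and never leads
    into [j] in one step would cut [j] off from its members, which
    irreducibility forbids; so the set is empty. *)
Lemma irreducible_closed P (S : pred 'I_n) (i j : 'I_n) :
  row_stochastic P -> irreducible_mx P ->
  (forall a b, S a -> 0 < P a b -> S b && (b != j)) -> ~~ S i.
Proof.
move=> [P0 _] irr SP; apply/negP => Si.
have [m m_gt0] := irr i j.
(* Every state charged by a positive power of [P] from [i] lies in [S] and is
   not [j]; this contradicts the choice of [m]. *)
suff H k : forall b, 0 < (P ^+ k.+1) i b -> S b && (b != j).
  by case: m m_gt0 => // m _ /H; rewrite eqxx andbF.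
have Pk0 k' a b : 0 <= (P ^+ k') a b.
  elim: k' a b => [|k' IH] a b; first by rewrite expr0 mxE mulrn_wge0 ?ler01.
  by rewrite exprSr mxE sumr_ge0 // => c _; rewrite mulr_ge0.
elim: k => [|k IH] b; first by rewrite expr1; exact: SP.
rewrite exprSr mxE => pos.
have /existsP [a /andP[a1 a2]] :
    [exists a, (0 < (P ^+ k.+1) i a) && (0 < P a b)].
  apply: contraTT pos => /existsPn none; rewrite -leNgt big1 // => a _.
  have := none a; rewrite !lt_neqAle !Pk0 P0 !andbT negb_and !negbK.
  by case/orP => /eqP <-; rewrite ?mul0r ?mulr0.
by apply: SP a2; case/andP: (IH _ a1).
Qed.

(** Minimum principle. At a negative minimum, a superharmonic function of the
    killed chain must take the same value at every successor and cannot lose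
    mass to [j]; the set of minimizers would then contradict
    [irreducible_closed]. *)
Lemma taboo_minimum P (j : 'I_n) x : row_stochastic P -> irreducible_mx P ->
  (forall a, (taboo P j *m x) a 0 <= x a 0) -> forall a, 0 <= x a 0.
Proof.
move=> stP irr super a0; have [P0 P1] := stP.
case: (arg_minP (fun a => x a 0) (erefl : xpredT a0)) => i _ min_i.
suff: 0 <= x i 0 by move/le_trans; apply; exact: min_i.
rewrite leNgt; apply/negP => neg.
suff: ~~ (x i 0 == x i 0) by rewrite eqxx.
apply: (@irreducible_closed P (fun a => x a 0 == x i 0) i j) => // a b.
move=> /eqP xa Pab.
(* The killed average of [x] is at least the full average of the minimum, term
   by term; superharmonicity at [a] forces equality in every term. *)
have gap_ge0 c : 0 <= (taboo P j) a c * x c 0 - P a c * x i 0.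
  rewrite mxE; case: eqP => [_|_] /=.
    by rewrite mulr0n mul0r sub0r -mulrN mulr_ge0 // oppr_ge0 ltW.
  by rewrite mulr1n -mulrBr mulr_ge0 // subr_ge0 min_i.
have sum_gap : \sum_c ((taboo P j) a c * x c 0 - P a c * x i 0) = 0.
  apply/eqP; rewrite eq_le sumr_ge0 // andbT.
  rewrite sumrB -mulr_suml P1 mul1r subr_le0 -xa.
  by have := super a; rewrite mxE.
have /eqP := psumr_eq0P (fun c _ => gap_ge0 c) sum_gap (i := b) isT.
rewrite mxE; case: (eqVneq b j) => _ /=.
  by rewrite mulr0n mul0r sub0r oppr_eq0 mulf_eq0 gt_eqF //= lt_eqF.
by rewrite mulr1n -mulrBr mulf_eq0 gt_eqF //= subr_eq0 andbT.
Qed.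

(** The minimum principle applies to [x] and to [- x]. *)
Lemma taboo_fixpoint0 P (j : 'I_n) x : row_stochastic P -> irreducible_mx P ->
  taboo P j *m x = x -> x = 0.
Proof.
move=> stP irr fx; apply/matrixP => a b; rewrite [b]ord1 mxE; apply/le_anti.
rewrite (@taboo_minimum P j x) ?andbT //; last by move=> c; rewrite fx.
rewrite -oppr_ge0 -[- x a 0]/(- (x a 0)).
have := @taboo_minimum P j (- x) stP irr _ a; rewrite mxE; apply => c.
by rewrite mulmxN fx.
Qed.

(** The series is the minimal nonnegative solution of [x = r + T x]: its partial
    sums stay below any solution [x], which is nonnegative by the minimum
    principle, so it converges to a solution, and the solution is unique. *)
Lemma taboo_series P (j : 'I_n) r x : row_stochastic P -> irreducible_mx P ->
  (forall a, 0 <= r a 0) -> x = r + taboo P j *m x ->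
  forall i, (\sum_(0 <= k <oo) ((taboo P j ^+ k *m r) i 0)%:E)%E = (x i 0)%:E.
Proof.
move=> stP irr r0 xE; set T := taboo P j.
have T0 a b : 0 <= T a b by apply: taboo_ge0; exact: stP.1.
have x0 : forall a, 0 <= x a 0.
  apply: (taboo_minimum (P := P) (j := j)) => // a.
  by rewrite [in leRHS]xE [leRHS]mxE lerDr.
have TrS k : T ^+ k.+1 *m r = T *m (T ^+ k *m r) by rewrite exprS -mulmxA.
have Tr0 k a : 0 <= (T ^+ k *m r) a 0.
  elim: k a => [|k IH] a; first by rewrite expr0 mul1mx.
  by rewrite TrS mxE sumr_ge0 // => b _; rewrite mulr_ge0.
pose S i := (\sum_(0 <= k <oo) ((T ^+ k *m r) i 0)%:E)%E.
have S0 i : (0 <= S i)%E by apply: nneseries_ge0 => k _ _; rewrite lee_fin.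
have partial_le N a : \sum_(k < N) (T ^+ k *m r) a 0 <= x a 0.
  elim: N a => [|N IH] a; first by rewrite big_ord0.
  rewrite big_ord_recl expr0 mul1mx xE [leRHS]mxE lerD2l.
  under eq_bigr do rewrite TrS mxE.
  rewrite exchange_big /= mxE; apply: ler_sum => b _.
  by rewrite -mulr_sumr ler_wpM2l.
have S_le i : (S i <= (x i 0)%:E)%E.
  apply: lime_le; first by apply: is_cvg_nneseries => k _ _; rewrite lee_fin.
  by apply: nearW => N; rewrite big_mkord sumEFin lee_fin partial_le.
have SE i : S i = (fine (S i))%:E.
  by rewrite fineK // ge0_fin_numE // (le_lt_trans (S_le i)) ?ltry.
pose s : 'cV[R]_n := \col_i fine (S i).
have sE : s = r + T *m s.
  apply/matrixP => i b; rewrite [b]ord1; apply: EFin_inj.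
  rewrite mxE -SE [in RHS]mxE EFinD {1}/S.
  rewrite nneseries_recl //; last by move=> k _; rewrite lee_fin.
  rewrite expr0 mul1mx; congr (_ + _)%E.
  rewrite -(@nneseries_addn _ _ 1) => [|k]; last by rewrite lee_fin.
  rewrite mxE -sumEFin; under [RHS]eq_bigr do rewrite [s _ _]mxE EFinM -SE.
  have Zl c : (\sum_(0 <= k <oo) (T i c * (T ^+ k *m r) c 0)%:E =
      (T i c)%:E * S c)%E.
    by rewrite -nneseriesZl // => k _; rewrite lee_fin.
  under [RHS]eq_bigr do rewrite -Zl.
  rewrite -nneseries_sum => [|c k _]; last by rewrite lee_fin mulr_ge0.
  by apply: eq_eseriesr => k _; rewrite addn1 TrS mxE sumEFin.
move=> i; rewrite -/(S i) SE; congr EFin.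
suff: x - s = 0.
  by move/eqP; rewrite subr_eq0 => /eqP ->; rewrite mxE.
apply: (@taboo_fixpoint0 P j) => //.
by rewrite mulmxBr [in RHS]xE [in RHS]sE opprD addrACA subrr add0r.
Qed.

(** * Invertibility of the fundamental matrix *)

(** The states of zero stationary mass are closed under predecessors; if [j] is
    one of them, the states of positive mass never lead into [j]. *)
Lemma stationary_gt0 P pi : row_stochastic P -> irreducible_mx P ->
  stationary P pi -> forall j, 0 < pi 0 j.
Proof.
move=> stP irr [pi0 pi1 piP] j; rewrite lt_def pi0 andbT; apply/eqP => pij.
have zero i : pi 0 i == 0.
  rewrite -[_ == _]negbK.
  apply: (@irreducible_closed P (fun a => pi 0 a != 0) i j) => // a b pia Pab.
  have pib : pi 0 b != 0.
    apply: contra_neqN pia => /eqP pib; rewrite -piP mxE in pib.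
    have nn c : true -> 0 <= pi 0 c * P c b.
      by move=> _; rewrite mulr_ge0 // stP.1.
    have /eqP := psumr_eq0P nn pib (i := a) isT.
    by rewrite mulf_eq0 (gt_eqF Pab) orbF => /eqP.
  by rewrite pib; apply: contraNneq pib => ->; apply/eqP.
by move: pi1; rewrite big1 => [/eqP|i _]; [rewrite eq_sym oner_eq0|exact/eqP].
Qed.

Lemma stochastic_ones P : row_stochastic P -> P *m ones R n = ones R n.
Proof.
move=> [_ P1]; apply/matrixP => i j; rewrite !mxE -[RHS](P1 i).
by apply: eq_bigr => k _; rewrite mxE mulr1.
Qed.

(** Subtracting its value at [j] from a harmonic function gives a harmonic
    function that vanishes at [j], hence a fixed point of the chain killed at
    [j]. *)
Lemma harmonic_const P x (j : 'I_n) : row_stochastic P -> irreducible_mx P ->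
  P *m x = x -> x = x j 0 *: ones R n.
Proof.
move=> stP irr Px; apply/eqP; rewrite -subr_eq0; apply/eqP.
apply: (@taboo_fixpoint0 P j) => //.
set y := x - _; have Py : P *m y = y.
  by rewrite mulmxBr -scalemxAr stochastic_ones // Px.
have yj : y j 0 = 0 by rewrite !mxE mulr1 subrr.
rewrite -[RHS]Py; apply/matrixP => a b; rewrite [b]ord1 !mxE.
apply: eq_bigr => c _; rewrite mxE.
by have [->|_] := eqVneq c j; rewrite ?yj ?mulr0.
Qed.

Lemma mulmx_row_ones (v : 'rV[R]_n) : v *m ones R n = (\sum_i v 0 i)%:M.
Proof.
apply/matrixP => i j; rewrite !mxE !ord1 eqxx mulr1n.
by apply: eq_bigr => k _; rewrite mxE mulr1.
Qed.

(** Multiplying a kernel vector by [pi] shows that [pi] annihilates it, so the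
    vector is harmonic, hence constant, hence zero. *)
Lemma fundamental_unit P pi : row_stochastic P -> irreducible_mx P ->
  stationary P pi -> 1%:M - P + ones R n *m pi \in unitmx.
Proof.
move=> stP irr [pi0 pi1 piP].
rewrite -unitmx_tr -row_free_unit -kermx_eq0; apply/rowV0P => v /sub_kermxP.
move/(congr1 trmx); rewrite trmx_mul trmxK trmx0 => ker.
have piv : pi *m v^T = 0.
  have := congr1 (mulmx pi) ker.
  rewrite mulmx0 mulmxA mulmxDr mulmxBr mulmx1 piP subrr add0r mulmxA.
  by rewrite mulmx_row_ones pi1 mul1mx.
have Pv : P *m v^T = v^T.
  move: ker; rewrite mulmxDl mulmxBl mul1mx -mulmxA piv mulmx0 addr0.
  by move/eqP; rewrite subr_eq0 => /eqP.
apply/matrixP => a j; rewrite [a]ord1 [RHS]mxE.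
have cst := harmonic_const j stP irr Pv.
move: piv; rewrite cst -scalemxAr mulmx_row_ones pi1.
by move/matrixP/(_ 0 0); rewrite !mxE eqxx mulr1.
Qed.

(** * The first-step equation *)

Lemma dgE (V : nmodType) (A : 'M[V]_n) i j : dg A i j = A i i *+ (i == j).
Proof. by rewrite !mxE. Qed.

Lemma invmx_diag pi : (forall i, pi 0 i != 0) ->
  invmx (diag_mx pi) = diag_mx (\row_i (pi 0 i)^-1).
Proof.
move=> pi0; have E : diag_mx pi *m diag_mx (\row_i (pi 0 i)^-1) = 1%:M.
  rewrite mulmx_diag -[RHS]diag_const_mx; congr diag_mx.
  by apply/rowP => i; rewrite !mxE divff.
have [u _] := mulmx1_unit E.
by rewrite -[RHS](mulKmx u) E mulmx1.
Qed.

Lemma invmx_diagE pi i j : (forall i, pi 0 i != 0) ->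
  invmx (diag_mx pi) i j = (pi 0 i)^-1 *+ (i == j).
Proof. by move=> pi0; rewrite invmx_diag // !mxE. Qed.

(** The closed form of the matrix of mean first passage times, where [B] stands
    for the matrix with entries P(a, b) W(a, b). It depends on the weights only
    through [B], so [B = P] covers the unweighted chain. *)
Definition passage_mx P pi B : 'M[R]_n :=
  let one := ones R n in
  let Z := Zmx P pi in
  let A := Z *m B *m (one *m pi) in
  (A - one *m one^T *m dg A
   + (pi *m B *m one) 0 0 *: (1%:M - Z + one *m one^T *m dg Z))
  *m invmx (diag_mx pi).

Lemma ones_dg_diag (A : 'M[R]_n) i :
  (ones R n *m (ones R n)^T *m dg A) i i = A i i.
Proof.
rewrite /dg mxE (bigD1 i) //= big1 ?addr0 => [|k ki].
  by rewrite !mxE big_ord1 !mxE eqxx mulr1n !mul1r.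
by rewrite [X in _ * X]mxE (negbTE ki) mulr0n mulr0.
Qed.

Lemma passage_mx_diag P pi B i : (forall i, pi 0 i != 0) ->
  passage_mx P pi B i i = (pi *m B *m ones R n) 0 0 / pi 0 i.
Proof.
move=> pi0; rewrite /passage_mx invmx_diag // mul_mx_diag [LHS]mxE.
congr (_ * _); last by rewrite mxE.
rewrite [LHS]mxE [X in X + _]mxE [X in _ + X + _]mxE ones_dg_diag subrr add0r.
rewrite [LHS]mxE [X in _ * X]mxE ones_dg_diag.
by move: (Zmx P pi) => Z; rewrite !mxE eqxx subrK mulr1.
Qed.

(** First-step analysis: the first transition earns [B *m ones R n] on average,
    and unless it already ends at the target, which accounts for the removed
    diagonal, the remaining weight is that of a fresh passage. Since
    [(I - P) Z = I - 1 pi] and [I - P] kills the constant columns, applying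
    [I - P] to the closed form leaves exactly these terms. *)
Lemma passage_mx_eq P pi B : row_stochastic P -> irreducible_mx P ->
  stationary P pi ->
  passage_mx P pi B = B *m ones R n *m (ones R n)^T
    + P *m (passage_mx P pi B - dg (passage_mx P pi B)).
Proof.
move=> stP irr st; have [_ pi1 piP] := st.
have pi0 i : pi 0 i != 0 by rewrite gt_eqF // (stationary_gt0 stP irr st).
have uD : diag_mx pi \in unitmx.
  by rewrite unitmxE det_diag unitfE; apply/prodf_neq0 => i _.
set M := passage_mx P pi B; set one := ones R n.
have uZ := fundamental_unit stP irr st.
set Z := Zmx P pi; pose c := (pi *m B *m one) 0 0.
have ZE : (1%:M - P + one *m pi) *m Z = 1%:M by rewrite /Z mulmxV.
have piZ : pi *m Z = pi.
  have E : pi *m (1%:M - P + one *m pi) = pi.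
    rewrite mulmxDr mulmxBr mulmx1 piP subrr add0r mulmxA.
    by rewrite mulmx_row_ones pi1 mul1mx.
  by rewrite -[in LHS]E mulmxK.
have IPZ : (1%:M - P) *m Z = 1%:M - one *m pi.
  by apply/eqP; rewrite eq_sym subr_eq -[X in X == _]ZE mulmxDl -mulmxA piZ.
have IPone : (1%:M - P) *m one = 0.
  by rewrite mulmxBl mul1mx stochastic_ones // subrr.
have dgM : dg M = c *: invmx (diag_mx pi).
  apply/matrixP => i j; rewrite dgE passage_mx_diag // -/one -/c.
  by rewrite [RHS]mxE invmx_diagE // mulrnAr.
have oneT : one^T = pi *m invmx (diag_mx pi).
  by rewrite invmx_diag //; apply/rowP => i; rewrite mul_mx_diag !mxE divff.
have IPone0 m (C : 'M[R]_(1, m)) D :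
    (1%:M - P) *m (one *m C *m D) = 0 :> 'M[R]_n.
  by rewrite !mulmxA IPone !mul0mx.
have cE : one *m pi *m (B *m (one *m pi)) = c *: (one *m pi).
  rewrite -mulmxA (mulmxA B) (mulmxA pi) (mulmxA pi).
  by rewrite [pi *m B *m one]mx11_scalar mul_scalar_mx -scalemxAr.
have IPA : (1%:M - P) *m (Z *m B *m (one *m pi))
    = B *m (one *m pi) - c *: (one *m pi).
  by rewrite -(mulmxA Z) mulmxA IPZ mulmxBl mul1mx cE.
have IPM : (1%:M - P) *m M = (B *m (one *m pi) - c *: P) *m invmx (diag_mx pi).
  rewrite /M /passage_mx -/one -/Z -/c mulmxA; congr (_ *m _).
  rewrite mulmxDr mulmxBr IPA IPone0 subr0 -scalemxAr mulmxDr IPone0 addr0.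
  rewrite mulmxBr mulmx1 IPZ -addrA; congr (_ + _).
  by rewrite opprB [_ - _ + _]addrC addrA subrK scalerBr addKr.
have : M - P *m M = B *m one *m one^T - P *m dg M.
  rewrite -{1}[M]mul1mx -mulmxBl IPM dgM mulmxBl -scalemxAl -scalemxAr oneT.
  by rewrite !mulmxA.
by move/eqP; rewrite subr_eq mulmxBr addrCA [X in _ == X]addrC => /eqP.
Qed.

(** The first-step equation read one target at a time: removing the diagonal of
    the matrix amounts to killing the chain at the target. *)
Lemma passage_mx_column P pi B j :
  row_stochastic P -> irreducible_mx P -> stationary P pi ->
  col j (passage_mx P pi B) =
  B *m ones R n + taboo P j *m col j (passage_mx P pi B).
Proof.
move=> stP irr st; set M := passage_mx P pi B.
have ME : M = B *m ones R n *m (ones R n)^T + P *m (M - dg M).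
  exact: passage_mx_eq.
apply/matrixP => i k; rewrite [k]ord1 [LHS]mxE [in LHS]ME [LHS]mxE [RHS]mxE.
congr (_ + _).
  by rewrite [LHS]mxE big_ord1 [X in _ * X]mxE [X in _ * X]mxE mulr1.
rewrite mxE [RHS]mxE; apply: eq_bigr => a _; move: (M) => N.
rewrite !mxE; case: eqVneq => [->|_]; last by rewrite subr0 mulr1n.
by rewrite subrr mulr0 mul0r.
Qed.

End LinearAlgebra.

(** * The Markov property *)

Lemma measure_partition (R : realType) (d : measure_display)
    (T : measurableType d) (mu : {measure set T -> \bar R}) (F : finType)
    (Y : T -> F) (A : set T) :
  measurable A -> (forall x, measurable (Y @^-1` [set x])) ->
  mu A = (\sum_(x : F) mu (A `&` Y @^-1` [set x]))%E.
Proof.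
move=> mA mY.
rewrite [X in mu X](_ : A =
    \bigcup_(x in [set` index_enum F]) (A `&` Y @^-1` [set x])).
  rewrite measure_fin_bigcup //.
  - by apply/esym/fsbig_seq/index_enum_uniq.
  - by move=> x y _ _ [t [[_ <-] [_ <-]]].
  - by move=> x _; exact: measurableI.
apply/seteqP; split => [t At|t [x _ []]//].
by exists (Y t) => //=; rewrite mem_index_enum.
Qed.

Section Avoidance.
Variables (n : nat) (d : measure_display) (Omega : measurableType d).
Implicit Types X : nat -> Omega -> 'I_n.

(** The event that the target has not been entered by time [k], so that
    transition [k.+1] still counts. Time 0 is exempt, because the passage time
    is a return time when the chain starts at its target. *)
Definition avoid X (j : 'I_n) (k : nat) : set Omega :=
  [set om | forall l, (0 < l <= k)%N -> X l om != j].

Lemma avoidE X j k :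
  avoid X j k = \bigcap_(l in [set l | (0 < l <= k)%N]) ~` (X l @^-1` [set j]).
Proof.
by apply/seteqP; split => om H l /H => [/eqP|/= Xl] //; apply/eqP.
Qed.

Lemma history_measurable X k (x : {ffun 'I_k.+1 -> 'I_n}) :
  (forall k a, measurable (X k @^-1` [set a])) ->
  measurable ((fun om => [ffun l : 'I_k.+1 => X l om]) @^-1` [set x]).
Proof.
move=> mX; rewrite [X in measurable X](_ : _ =
    \bigcap_(l in [set: 'I_k.+1]) (X l @^-1` [set x l])).
  by apply: fin_bigcap_measurable => // l _; exact: mX.
apply/seteqP; split => [om <- l _ /=|om H]; first by rewrite ffunE.
by apply/ffunP => l; rewrite ffunE; exact: H.
Qed.

(** Stated for any measurable structure on [Omega], so that it also applies to
    the sigma-algebra generated by the chain. *)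
Lemma avoid_measurable X j k :
  (forall k a, measurable (X k @^-1` [set a])) -> measurable (avoid X j k).
Proof.
move=> mX; rewrite avoidE; apply: bigcap_measurableType => l _.
exact: measurableC.
Qed.

Lemma avoid_history X j k om om' :
  (forall l, (l <= k)%N -> X l om = X l om') ->
  avoid X j k om -> avoid X j k om'.
Proof.
by move=> e av l /andP[l0 lk]; rewrite -e //; apply: av; rewrite l0.
Qed.

End Avoidance.

Section Chain.
Variables (R : realType) (n : nat) (d : measure_display)
  (Omega : measurableType d).
Implicit Types (X : nat -> Omega -> 'I_n) (P : 'M[R]_n).

(** Only cylinders are governed by the axioms of a chain, so the event [A] is
    split along the finitely many histories up to time [k]; each nonempty piece
    is a cylinder. *)
Lemma markov_property (mu : probability Omega R) P i X :
  markov_chain mu P i X ->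
  forall (k : nat) (a b : 'I_n) (A : set Omega), measurable A ->
  (forall om om', (forall l, (l <= k)%N -> X l om = X l om') ->
     A om -> A om') ->
  mu (A `&` X k @^-1` [set a] `&` X k.+1 @^-1` [set b]) =
  (mu (A `&` X k @^-1` [set a]) * (P a b)%:E)%E.
Proof.
move=> [mX _ step] k a b A mA detA.
pose Y om := [ffun l : 'I_k.+1 => X l om].
have mY x : measurable (Y @^-1` [set x]) by exact: history_measurable.
have YE om om' : Y om = Y om' -> forall l, (l <= k)%N -> X l om = X l om'.
  move=> e l lk; have /ffunP/(_ (Ordinal (lk : (l < k.+1)%N))) := e.
  by rewrite !ffunE.
have mAa : measurable (A `&` X k @^-1` [set a]) by exact: measurableI.
rewrite (measure_partition mu _ mY); last exact: measurableI.
rewrite [X in (X * _)%E](measure_partition mu _ mY) //.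
rewrite ge0_sume_distrl => [|x _]; last exact: measure_ge0.
apply: eq_bigr => x _.
have [[om0 [[Aom0 /= Xom0] /= Yom0]]|none] :=
    pselect (A `&` X k @^-1` [set a] `&` Y @^-1` [set x] !=set0); last first.
  have E0 : A `&` X k @^-1` [set a] `&` Y @^-1` [set x] = set0.
    by apply/eqP/negPn; apply/negP => /set0P.
  by rewrite setIAC E0 set0I !measure0 mul0e.
(* The history of [om0] up to time [k], prolonged by [b]. *)
pose p l := if (l <= k)%N then X l om0 else b.
have -> : A `&` X k @^-1` [set a] `&` Y @^-1` [set x] =
    [set om | forall l, (l <= k)%N -> X l om = p l].
  apply/seteqP; split => [om [_ Yom] l lk|om H].
    by rewrite /p lk; apply: YE lk; rewrite Yom.
  have e l : (l <= k)%N -> X l om0 = X l om by move=> lk; rewrite H // /p lk.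
  split; first by split; [exact: detA Aom0 | rewrite /= -e].
  by rewrite /= -[RHS]Yom0; apply/ffunP => l; rewrite !ffunE e // -ltnS.
have -> : A `&` X k @^-1` [set a] `&` X k.+1 @^-1` [set b] `&` Y @^-1` [set x]
    = [set om | forall l, (l <= k.+1)%N -> X l om = p l].
  apply/seteqP; split => [om [[_ Xb] Yom] l|om H].
    rewrite leq_eqVlt => /orP[/eqP ->|lk]; first by rewrite /p ltnn.
    by rewrite /p -ltnS lk; apply: YE lk; rewrite Yom.
  have e l : (l <= k)%N -> X l om0 = X l om.
    by move=> lk; rewrite H ?leqW // /p lk.
  split; last first.
    by rewrite /= -[RHS]Yom0; apply/ffunP => l; rewrite !ffunE e // -ltnS.
  split; first by split; [exact: detA Aom0 | rewrite /= -e].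
  by rewrite /= H // /p ltnn.
by rewrite step /p leqnn ltnn Xom0.
Qed.

Lemma avoid_prob (mu : probability Omega R) P i X j k a :
  markov_chain mu P i X ->
  mu (avoid X j k `&` X k @^-1` [set a]) = ((taboo P j ^+ k) i a)%:E.
Proof.
move=> mc; have [mX start _] := mc.
elim: k a => [|k IH] a.
  rewrite expr0 mxE [avoid X j 0](_ : _ = setT); last first.
    by apply/seteqP; split => // om _ [|l].
  rewrite setTI; case: eqVneq => [<-//|ai] /=.
  apply/eqP; rewrite eq_le measure_ge0 andbT.
  have <- : mu (~` (X 0%N @^-1` [set i])) = 0%:E.
    by rewrite probability_setC // start subee.
  rewrite le_measure ?inE //; first exact: measurableC.
  by move=> om /= ->; apply/eqP; rewrite eq_sym.
rewrite exprSr mxE -sumEFin.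
have [->|aj] := eqVneq a j.
  rewrite big1 => [|b _]; last by rewrite mxE eqxx mulr0.
  rewrite [X in mu X](_ : _ = set0) ?measure0 //.
  by apply/seteqP; split => // om [/(_ k.+1) /= H /eqP]; rewrite (negbTE (H _)).
rewrite (_ : _ `&` _ = avoid X j k `&` X k.+1 @^-1` [set a]); last first.
  apply/seteqP; split => om [av Xa]; split => //.
    by move=> l /andP[l0 lk]; apply: av; rewrite l0 leqW.
  move=> l /andP[l0]; rewrite leq_eqVlt => /orP[/eqP ->|lk].
    by rewrite Xa.
  by apply: av; rewrite l0.
rewrite (measure_partition mu (Y := X k)) //; last first.
  by apply: measurableI => //; exact: avoid_measurable.
apply: eq_bigr => b _; rewrite setIAC [LHS](markov_property mc) ?IH.
- by rewrite mxE aj EFinM.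
- exact: avoid_measurable.
- by move=> om om'; exact: avoid_history.
Qed.

(** * Passage times as series *)

Lemma le_hitting_time X j om k :
  ((k.+1%:R : R)%:E <= hitting_time R X j om)%E = (om \in avoid X j k).
Proof.
apply/idP/idP => [le_k|/set_mem av].
  apply/mem_set => l /andP[l0 lk]; apply/eqP => Xl.
  have : (hitting_time R X j om <= l%:R%:E)%E.
    by apply: ereal_inf_lbound; exists l.
  by move/(le_trans le_k); rewrite lee_fin ler_nat ltnNge lk.
apply: le_ereal_inf_tmp => _ [m [m0 Xm] <-].
rewrite lee_fin ler_nat ltnNge; apply/negP => mk.
by have := av m; rewrite m0 mk Xm eqxx => /(_ isT).
Qed.

Lemma weighted_hitting_timeE X (w : nat -> 'I_n -> 'I_n -> {mfun Omega >-> R})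
    j om : (forall k a b, 0 <= w k a b om) ->
  weighted_hitting_time X w j om =
  (\sum_(0 <= k <oo) if om \in avoid X j k
     then (w k.+1 (X k om) (X k.+1 om) om)%:E else 0)%E.
Proof.
move=> w0; rewrite /weighted_hitting_time eseries_mkcond -(nneseries_addn 1).
  by apply: eq_eseriesr => k _; rewrite addn1 le_hitting_time.
by move=> k; case: ifP => // _; rewrite lee_fin.
Qed.

Lemma hitting_timeE X j om :
  hitting_time R X j om =
  (\sum_(0 <= k <oo) if om \in avoid X j k then 1 else 0)%E.
Proof.
have f0 k : (0 <= if om \in avoid X j k then 1 else 0 :> \bar R)%E.
  by case: ifP => _; rewrite ?lee01.
have [/cid2[m0 m0_gt0 Xm0]|never] :=
    pselect (exists2 m, (0 < m)%N & X m om = j).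
  have ex : exists m, (0 < m)%N && (X m om == j).
    by exists m0; rewrite m0_gt0 Xm0 /=.
  case: (ex_minnP ex) => -[//|m] /andP[_ /eqP Xm] min_m.
  have avE k : (om \in avoid X j k) = (k <= m)%N.
    apply/idP/idP => [/set_mem av|km].
      rewrite leqNgt; apply/negP => mk.
      by have := av m.+1; rewrite mk Xm eqxx => /(_ isT).
    apply/mem_set => l /andP[l0 lk]; apply/negP => Xl.
    by have := min_m l; rewrite l0 Xl ltnNge (leq_trans lk km) => /(_ isT).
  transitivity ((m.+1%:R : R)%:E).
    apply/le_anti; rewrite le_hitting_time avE leqnn andbT.
    by apply: ereal_inf_lbound; exists m.+1.
  rewrite (nneseries_split 0 m.+1) // add0n.
  rewrite [X in (_ + X)%E]eseries0 ?adde0 => [|k mk _]; last first.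
    by rewrite avE leqNgt mk.
  rewrite big_nat (eq_bigr (fun=> 1%E)) => [|k]; last first.
    by rewrite ltnS avE /= => ->.
  by rewrite -big_nat big_mkord sumEFin sumr_const card_ord.
have av k : om \in avoid X j k.
  by apply/mem_set => l /andP[l0 _]; apply/eqP => Xl; apply: never; exists l.
rewrite /hitting_time [X in ereal_inf X](_ : _ = set0); last first.
  by apply/seteqP; split => // x [m [m0 Xm] _]; case: never; exists m.
rewrite ereal_inf0; apply/esym/eqyP => A A0.
apply: le_trans (nneseries_lim_ge (Num.bound A) (fun k _ _ => f0 k)).
under eq_bigr do rewrite av.
rewrite big_mkord sumEFin sumr_const card_ord lee_fin.
by apply/ltW/archi_boundP/ltW.
Qed.

(** Passage times are weighted passage times for unit weights, so that [L] and
    [M] are computed by the same argument. *)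
Lemma hitting_time_unit_weight X j om :
  hitting_time R X j om =
  weighted_hitting_time X (fun _ _ _ => cst 1 : {mfun Omega >-> R}) j om.
Proof. by rewrite hitting_timeE weighted_hitting_timeE. Qed.

(** * Mean passage times *)

(** On [A], the variable [f] behaves like an independent copy of [g]: its law
    under the restriction of [mu] to [A] is [mu A] times the law of [g], and
    integrals of [f] depend on that law only. *)
Lemma integral_indep (mu : probability Omega R) (dT : measure_display)
    (T : measurableType dT) (Q : probability T R) (f : {mfun Omega >-> R})
    (g : {mfun T >-> R}) (A : set Omega) :
  measurable A -> (forall om, 0 <= f om) -> (forall t, 0 <= g t) ->
  (forall C : set R, measurable C ->
    mu (A `&` f @^-1` C) = mu A * distribution Q g C)%E ->
  (\int[mu]_(om in A) (f om)%:E = mu A * \int[Q]_t (g t)%:E)%E.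
Proof.
move=> mA f0 g0 indep.
have mf : measurable_fun setT (fun om => (f om)%:E) by exact/measurable_EFinP.
pose nu : {measure set Omega -> \bar R} := mrestr mu mA.
have -> : (\int[mu]_(om in A) (f om)%:E = \int[nu]_(om in A) (f om)%:E)%E.
  by apply: eq_measure_integral => B mB BA; rewrite /nu /= /mrestr setIidl.
have -> : (\int[nu]_(om in A) (f om)%:E = \int[nu]_om (f om)%:E)%E.
  rewrite [RHS](@ge0_negligible_integral _ _ _ _ _ (~` A)) //.
  - by rewrite setTD setCK.
  - exact: measurableC.
  - by move=> om _; rewrite lee_fin.
  - by rewrite /nu /= /mrestr setICl measure0.
(* The absolute value makes the integrand nonnegative on the whole line. *)
pose h (y : R) : \bar R := `|y|%:E.
have mh : measurable_fun setT h.
  by apply/measurable_EFinP; exact: normr_measurable.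
have -> : (\int[nu]_om (f om)%:E = \int[pushforward nu f]_y h y)%E.
  rewrite ge0_integral_pushforward //=.
    by apply: eq_integral => om _; rewrite /h ger0_norm.
  by move=> y _; rewrite lee_fin.
have k0 : 0 <= fine (mu A) by rewrite fine_ge0.
rewrite (eq_measure_integral (mscale (NngNum k0) (distribution Q g))).
  rewrite ge0_integral_mscale //=; last by move=> y _; rewrite lee_fin.
  rewrite fineK; last exact: fin_num_measure.
  congr (_ * _)%E; rewrite /distribution ge0_integral_pushforward //=.
    by apply: eq_integral => om _; rewrite /h ger0_norm.
  by move=> y _; rewrite lee_fin.
move=> C mC _; transitivity (mu (A `&` f @^-1` C)); first by rewrite setIC.
transitivity ((fine (mu A))%:E * distribution Q g C)%E => //.
by rewrite indep // fineK //; exact: fin_num_measure.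
Qed.

(** Transition [k.+1] is a traversal of the edge (a, b) exactly when the chain,
    not yet absorbed, is at [a] and then at [b]. These events belong to the
    chain, hence each contributes its probability times the mean weight of the
    edge; summing over edges and over time gives the killed-chain series. *)
Lemma expected_weight (mu : probability Omega R) P i X
    (w : nat -> 'I_n -> 'I_n -> {mfun Omega >-> R}) (B : 'M[R]_n) j :
  markov_chain mu P i X -> (forall k a b om, 0 <= w k a b om) ->
  (forall k a b A, sigma_chain X A ->
     \int[mu]_(om in A) (w k a b om)%:E = mu A * (B a b)%:E)%E ->
  (\int[mu]_om weighted_hitting_time X w j om =
   \sum_(0 <= k <oo)
     ((taboo P j ^+ k *m (hadamard P B *m ones R n)) i 0)%:E)%E.
Proof.
move=> mc w0 int_w; have mX := mc_measurable mc.
pose E k (p : 'I_n * 'I_n) : set Omega :=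
  avoid X j k `&` X k @^-1` [set p.1] `&` X k.+1 @^-1` [set p.2].
pose f k (p : 'I_n * 'I_n) om := (w k.+1 p.1 p.2 om)%:E.
have mE k p : measurable (E k p).
  apply: measurableI => //; apply: measurableI => //.
  exact: avoid_measurable.
have sE k p : sigma_chain X (E k p).
  pose G := g_sigma_algebraType [set A | exists k a, A = X k @^-1` [set a]].
  have mX' l a : @measurable _ G (X l @^-1` [set a]).
    by apply: sub_sigma_algebra; exists l, a.
  apply: (@measurableI _ G); last exact: mX'.
  by apply: (@measurableI _ G); [exact: (@avoid_measurable _ _ G) | exact: mX'].
have f0 k p om : (0 <= (f k p \_ (E k p)) om)%E.
  by rewrite patchE; case: ifP => // _; rewrite lee_fin.
have mf k p : measurable_fun setT (f k p \_ (E k p)).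
  have mfk : measurable_fun setT (f k p) by exact/measurable_EFinP.
  by apply/(measurable_restrictT _ (mE k p)); exact: measurable_funTS.
transitivity (\int[mu]_om
    (\sum_(0 <= k <oo) \sum_p (f k p \_ (E k p)) om))%E.
  apply: eq_integral => om _; rewrite weighted_hitting_timeE //.
  apply: eq_eseriesr => k _; case: ifPn => [/set_mem av|nav].
    rewrite (bigD1 (X k om, X k.+1 om)) //= big1 ?adde0 => [|[a b] ne].
      by rewrite patchE mem_set.
    rewrite patchE; case: ifPn => // /set_mem [[_ /= Xa] /= Xb].
    by move: ne; rewrite Xa Xb eqxx.
  rewrite big1 // => p _; rewrite patchE; case: ifPn => // /set_mem [[av _] _].
  by move: nav; rewrite mem_set.
rewrite integral_nneseries //; last 2 first.
- by move=> k; apply: emeasurable_sum => p; exact: mf.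
- by move=> k om _; rewrite sume_ge0.
apply: eq_eseriesr => k _; rewrite ge0_integral_sum //.
transitivity (\sum_(p : 'I_n * 'I_n)
    ((taboo P j ^+ k) i p.1 * (P p.1 p.2 * B p.1 p.2))%:E)%E.
  apply: eq_bigr => -[a b] _; rewrite -integral_mkcond int_w //=.
  rewrite (markov_property mc); last 2 first.
  - exact: avoid_measurable.
  - by move=> om om'; exact: avoid_history.
  by rewrite (avoid_prob j k a mc) // -!EFinM mulrA.
rewrite sumEFin; congr EFin; rewrite mxE.
under [RHS]eq_bigr do rewrite mxE mulr_sumr.
by rewrite pair_bigA /=; apply: eq_bigr => -[a b] _; rewrite !mxE mulr1.
Qed.

End Chain.

Lemma mean_weighted_hitting_time (R : realType) n (d : measure_display)
    (Omega : measurableType d) (mu : probability Omega R) (P : 'M[R]_n) pi i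
    (X : nat -> Omega -> 'I_n) (w : nat -> 'I_n -> 'I_n -> {mfun Omega >-> R})
    (B : 'M[R]_n) j :
  row_stochastic P -> irreducible_mx P -> stationary P pi ->
  markov_chain mu P i X -> (forall k a b om, 0 <= w k a b om) ->
  (forall a b, 0 <= B a b) ->
  (forall k a b A, sigma_chain X A ->
     \int[mu]_(om in A) (w k a b om)%:E = mu A * (B a b)%:E)%E ->
  (\int[mu]_om weighted_hitting_time X w j om)%E =
  (passage_mx P pi (hadamard P B) i j)%:E.
Proof.
move=> stP irr st mc w0 B0 int_w; rewrite (expected_weight j mc w0 int_w).
rewrite (taboo_series stP irr _ (passage_mx_column _ _ stP irr st)).
  by rewrite mxE.
move=> a; rewrite mxE sumr_ge0 // => b _.
by rewrite !mxE mulr1 mulr_ge0 // stP.1.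
Qed.

Lemma sigma_chain_measurable n (d : measure_display)
    (Omega : measurableType d) (X : nat -> Omega -> 'I_n) (A : set Omega) :
  (forall k a, measurable (X k @^-1` [set a])) ->
  sigma_chain X A -> measurable A.
Proof.
move=> mX; apply: smallest_sub; first exact: sigma_algebra_measurable.
by move=> _ [k [a ->]].
Qed.

Lemma weight_range_ge0 (R : realType) n (edge : rel 'I_n) (eps : R) (T : Type)
    (w : 'I_n -> 'I_n -> T -> R) :
  0 < eps -> weight_range edge eps w -> forall a b t, 0 <= w a b t.
Proof.
move=> eps0 rg a b t; have [in_range zero] := rg a b t.
have [/in_range|/zero -> //] := boolP (edge a b).
exact/le_trans/ltW.
Qed.

Lemma integral_mean_weight (R : realType) n (edge : rel 'I_n) (P : 'M[R]_n) eps
    pi (dT : measure_display) (T : measurableType dT) (Q : probability T R)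
    (W : 'I_n -> 'I_n -> {mfun T >-> R}) :
  weighted_markovian_graph edge P eps W -> assumptionA edge P pi Q W ->
  forall a b, (\int[Q]_t (W a b t)%:E = (mean_weight Q W a b)%:E)%E.
Proof.
move=> hG hA a b.
have W0 := weight_range_ge0 (wmg_eps_gt0 hG) (wmg_weight_range hG).
rewrite mxE unlock fineK // ge0_fin_numE; last first.
  by apply: integral_ge0 => t _; rewrite lee_fin.
have [ab|ab] := boolP (edge a b).
  by have := asmA_moment1 hA ab; rewrite unlock.
rewrite (eq_integral (fun=> 0%E)) ?integral0 ?ltry // => t _.
by have [_ ->] := wmg_weight_range hG a b t.
Qed.

Theorem theorem1 (R : realType) (n : nat)
  (edge : rel 'I_n) (P : 'M[R]_n) (eps : R)
  (dT : measure_display) (T : measurableType dT) (Q : probability T R)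
  (W : 'I_n -> 'I_n -> {mfun T >-> R}) (pi : 'rV[R]_n)
  (d : measure_display) (Omega : measurableType d)
  (mu : 'I_n -> probability Omega R)
  (X : nat -> Omega -> 'I_n)
  (w : nat -> 'I_n -> 'I_n -> {mfun Omega >-> R})
  (hG : weighted_markovian_graph edge P eps W)
  (hA : assumptionA edge P pi Q W)
  (hX : forall i : 'I_n, markov_chain (mu i) P i X)
  (hw : forall i : 'I_n, traversal_weights (mu i) edge eps Q W X w) :
  let M := mwfpt mu X w in
  let L := mfpt mu X in
  let one := ones R n in
  let PW := hadamard P (mean_weight Q W) in
  let c : R := (pi *m PW *m one) 0 0 in
  let Xi := diag_mx pi in
  let Pi := one *m pi in
  let Z := Zmx P pi in
  [/\ dg M = map_mx (fun x : \bar R => (c%:E * x)%E) (dg L),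
      dg M = map_mx EFin (c *: invmx Xi) &
      M = map_mx EFin
        ((Z *m PW *m Pi - one *m one^T *m dg (Z *m PW *m Pi)
          + c *: (1%:M - Z + one *m one^T *m dg Z)) *m invmx Xi)].
Proof.
have stP := wmg_stochastic hG; have irr := wmg_irreducible hG.
have st := (asmA_stationary hA).1.
have pi_neq0 i : pi 0 i != 0 by rewrite gt_eqF // (stationary_gt0 stP irr st).
have W0 := weight_range_ge0 (wmg_eps_gt0 hG) (wmg_weight_range hG).
have WE := integral_mean_weight hG hA.
move=> M L one PW c Xi Pi Z.
have ME : M = map_mx EFin (passage_mx P pi PW).
  apply/matrixP => i j; rewrite mxE [RHS]mxE.
  have w0 k := weight_range_ge0 (wmg_eps_gt0 hG) (tw_range (hw i) k).
  apply: mean_weighted_hitting_time => // [a b|k a b A XA].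
    by rewrite -lee_fin -WE integral_ge0 // => t _; rewrite lee_fin.
  rewrite -WE; apply: integral_indep => // [|C mC].
    exact: (sigma_chain_measurable (mc_measurable (hX i)) XA).
  rewrite (tw_indep (hw i)) //.
    by rewrite -(tw_law (hw i) k).
  by apply: sub_sigma_algebra; exists k, a, b, C.
have LE : L = map_mx EFin (passage_mx P pi P).
  apply/matrixP => i j; rewrite mxE [RHS]mxE.
  have PE : hadamard P (const_mx 1) = P.
    by apply/matrixP => a b; rewrite !mxE mulr1.
  under eq_integral do rewrite hitting_time_unit_weight.
  have -> : passage_mx P pi P = passage_mx P pi (hadamard P (const_mx 1)).
    by rewrite PE.
  apply: mean_weighted_hitting_time => // [a b|k a b A XA].
    by rewrite mxE.
  rewrite (eq_integral (cst 1%E)) // integral_cst; last first.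
    exact: (sigma_chain_measurable (mc_measurable (hX i)) XA).
  by rewrite mxE mul1e mule1.
have dgM : dg M = map_mx EFin (c *: invmx Xi).
  rewrite ME; apply/matrixP => i j; rewrite dgE mxE passage_mx_diag // -/c.
  rewrite [RHS]mxE [X in _ = X%:E]mxE invmx_diagE //.
  by case: eqVneq => _; rewrite ?mulr1n ?mulr0n ?mulr0.
have one_piP : (pi *m P *m ones R n) 0 0 = 1.
  by have [_ pi1 ->] := st; rewrite mulmx_row_ones pi1 mxE.
split => //.
rewrite dgM LE; apply/matrixP => i j.
rewrite [LHS]mxE [X in X%:E = _]mxE invmx_diagE // [RHS]mxE dgE.
rewrite [X in (_ * (X *+ _))%E]mxE passage_mx_diag //.
rewrite one_piP div1r.
by case: eqVneq => _; rewrite ?mulr1n ?mulr0n ?mulr0 ?mule0 // EFinM.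
Qed.
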